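(* Let $2\le k\leq r\leq n$ and $\mathcal{E}(r)=\{g_0=\emptyset,g_1,\ldots,g_m\}$. Define $f=(f_0,\ldots,f_m)^T$ by $$f_i=\begin{cases}(-1)^{|g_i|}\binom{n-cv(g_i)}{k-cv(g_i)} & \text{if } cv(g_i)\leq k \text{ and } |g_i|\neq\binom{k}{2},\text{ or } cv(g_i)<k,\\[2pt] 1+(-1)^{|g_i|}\binom{n-cv(g_i)}{k-cv(g_i)} & \text{if } cv(g_i)=k\text{ and }|g_i|=\binom{k}{2},\\[2pt] 0&\text{if } cv(g_i)>k.\end{cases}$$ Suppose that the minimum of $f^Tz$ over all integer vectors $z=(z_0,\ldots,z_m)^T\geq0$ with $z_0=1$ subject to the constraints $$\text{(I)}\quad -(E^{-1})^TDz\leq0,$$ $$\text{(II)}\quad z_iz_j-\sum_{l}c_{ij}^lz_l=0\quad\text{for all } i,j\text{ with } cv(g_i)+cv(g_j)\leq r,$$ is strictly positive, where $E$ is the $E$-transform of $\mathcal{E}(r)$ and $$D=\mathrm{diag}\left(\binom nr,\binom{n-cv(g_1)}{r-cv(g_1)},\ldots,\binom{n-cv(g_m)}{r-cv(g_m)}\right).$$ Then $r(k)\leq n$. In particular the minimal such $n\ge r$ (if it exists) is an upper bound for the Ramsey number $r(k)$.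
   Context: Graphs are finite and simple. The Ramsey number $r(k)$ is the minimum number $n$ such that every simple graph with $n$ vertices contains a clique of order $k$ or an independent set of order $k$. $\mathcal{E}(r)$ is the set of isomorphism classes of simple graphs with $r$ vertices. $I(g)(h)$ is the number of (not necessarily induced) subgraphs of $h$ isomorphic to $g$, isolated vertices being disregarded, with $I(\emptyset)=1$ for the edgeless graph $\emptyset$. $|g|$ is the number of edges of $g$ and $cv(g)$ the number of non-isolated vertices of $g$. The $E$-transform of $\mathcal{E}(r)$ is the (invertible) matrix $E=(e_{ij})$, $e_{ij}=I(g_j)(g_i)$, $0\le i,j\le m$. The coefficients in (II) are $c_{ij}^l=\sum_{h=0}^m(-1)^{|g_l|-|g_h|}e_{lh}e_{hi}e_{hj}$. Inequalities between vectors are componentwise. *)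

(* Defs.v *)
From HB Require Import structures.
From mathcomp Require Import all_boot all_order all_algebra.

Set Implicit Arguments.
Unset Strict Implicit.
Unset Printing Implicit Defensive.

Import Order.TTheory GRing.Theory Num.Theory.

Record sgraph (T : finType) := SGraph {
  edges : {set {set T}};
  edgesP : [forall e in edges, #|e| == 2]
}.

HB.instance Definition _ (T : finType) := [isSub for @edges T].
HB.instance Definition _ (T : finType) := [Finite of sgraph T by <:].

Section Graphs.
Variable T : finType.
Implicit Types (g h : sgraph T) (S : {set T}).

Lemma edgeless_subproof : [forall e in (set0 : {set {set T}}), #|e| == 2].
Proof. by apply/forall_inP => e; rewrite inE. Qed.

Definition edgeless : sgraph T := SGraph edgeless_subproof.

Definition adj g (x y : T) : bool := [set x; y] \in edges g.

Definition is_clique g S : bool :=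
  [forall x in S, forall y in S, (x != y) ==> adj g x y].

Definition is_independent g S : bool :=
  [forall x in S, forall y in S, ~~ adj g x y].

Definition edge_count g : nat := #|edges g|.

Definition nonisolated g : {set T} := cover (edges g).

Definition cv g : nat := #|nonisolated g|.

Lemma core_subproof g :
  [forall e in [set e : {set {x | x \in nonisolated g}} |
                [set val x | x in e] \in edges g], #|e| == 2].
Proof.
apply/forall_inP => e; rewrite inE => he.
by have /forall_inP/(_ _ he) := edgesP g; rewrite card_imset //; apply: val_inj.
Qed.

(* The graph left after deleting the isolated vertices. *)
Definition core g : sgraph {x | x \in nonisolated g} :=
  SGraph (core_subproof g).

End Graphs.

Definition isomorphic (T U : finType) (g : sgraph T) (h : sgraph U) : bool :=
  [exists f : {ffun T -> U},
    [&& injectiveb f, [forall y, y \in codom f]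
      & edges h == [set f @: (e : {set T}) | e in edges g]]].

(* Isolated vertices being disregarded, a subgraph of h is a set of edges of h,
   encoded as the graph with these edges on all the vertices of h.  *)
Definition subgraph_count (T U : finType) (g : sgraph T) (h : sgraph U) : nat :=
  #|[set s : sgraph U |
      (edges s \subset edges h) && isomorphic (core g) (core s)]|.

Definition ramsey_property (k n : nat) : bool :=
  [forall h : sgraph 'I_n, exists S : {set 'I_n},
    (#|S| == k) && (is_clique h S || is_independent h S)].

Lemma ramsey_aux (T : finType) (g : sgraph T) (s k l : nat) (A : {set T}) :
  k + l = s -> 2 ^ s <= #|A| ->
  exists2 S : {set T}, S \subset A &
    (#|S| == k) && is_clique g S || (#|S| == l) && is_independent g S.
Proof.
have irr x : adj g x x = false.
  apply/negP; rewrite /adj setUid => he.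
  by have /forall_inP/(_ _ he) := edgesP g; rewrite cards1.
have sym x y : adj g x y = adj g y x by rewrite /adj setUC.
elim: s k l A => [|s IHs] [|k] l A Ekl leA //.
1,2: by exists set0; rewrite ?sub0set // cards0 eqxx /=; apply/orP; left;
  apply/forall_inP => x; rewrite inE.
case: l Ekl => [|l] Ekl.
  exists set0; rewrite ?sub0set // cards0 eqxx orbC /=; apply/orP; left.
  by apply/forall_inP => x; rewrite inE.
have /card_gt0P[x xA] : 0 < #|A| by apply: leq_trans leA; rewrite expn_gt0.
pose N := [set y in A | adj g x y].
pose M := [set y in A :\ x | ~~ adj g x y].
have NM : #|A| <= #|N| + #|M| + 1.
  rewrite (cardsD1 x) xA addnC leq_add2r.
  apply: leq_trans (leq_card_setU N M); apply: subset_leq_card.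
  by apply/subsetP => y; rewrite !inE => /andP[-> ->]; case: (adj g x y).
have [leN | ltN] := leqP (2 ^ s) #|N|.
  have [|S SN] := IHs k l.+1 N _ leN; first by move: Ekl; rewrite !addSn => -[].
  have SA : S \subset A.
    by apply: subset_trans SN _; apply/subsetP=> y; rewrite inE => /andP[].
  case/orP => [/andP[cS clS] | iS]; last by exists S; rewrite ?iS ?orbT.
  have xS : x \notin S.
    by apply/negP => /(subsetP SN); rewrite inE irr andbF.
  exists (x |: S); first by rewrite subUset sub1set xA.
  rewrite cardsU1 xS (eqP cS) eqxx /=; apply/orP; left.
  apply/forall_inP => y /setU1P hy; apply/forall_inP => z /setU1P hz.
  apply/implyP; case: hy hz => [->|yS] [->|zS]; rewrite ?eqxx //.
  - by move=> _; have := subsetP SN _ zS; rewrite inE => /andP[].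
  - by move=> _; have := subsetP SN _ yS; rewrite inE sym => /andP[].
  - by apply/implyP; exact: (forall_inP (forall_inP clS _ yS) _ zS).
have leM : 2 ^ s <= #|M|.
  rewrite leqNgt; apply/negP => ltM; move: (leq_trans leA NM).
  rewrite addn1 expnS mul2n -addnn leqNgt => /negP; apply.
  by rewrite -addSn -addnS; apply: leq_add.
have [|S SM] := IHs k.+1 l M _ leM; first by move: Ekl; rewrite !addnS => -[].
have SA : S \subset A.
  apply: subset_trans SM _; apply/subsetP=> y.
  by rewrite !inE => /andP[/andP[_ ->]].
case/orP => [cS | /andP[cS iS]]; first by exists S; rewrite ?cS.
have xS : x \notin S by apply/negP => /(subsetP SM); rewrite !inE eqxx.
exists (x |: S); first by rewrite subUset sub1set xA.
rewrite cardsU1 xS (eqP cS) !eqxx /=; apply/orP; right.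
apply/forall_inP => y /setU1P hy; apply/forall_inP => z /setU1P hz.
case: hy hz => [->|yS] [->|zS]; rewrite ?irr //.
- by have := subsetP SM _ zS; rewrite inE => /andP[].
- by have := subsetP SM _ yS; rewrite inE sym => /andP[].
- exact: (forall_inP (forall_inP iS _ yS) _ zS).
Qed.

Lemma ramsey_exists (k : nat) : exists n, ramsey_property k n.
Proof.
exists (2 ^ (k + k)); apply/forallP => h.
have [|S _ hS] := @ramsey_aux _ h _ k k [set: _] erefl.
  by rewrite cardsT card_ord.
by apply/existsP; exists S; rewrite andb_orr.
Qed.

Definition ramsey_number (k : nat) : nat := ex_minn (ramsey_exists k).

Definition iso_class (r : nat) (g : sgraph 'I_r) : {set sgraph 'I_r} :=
  [set h | isomorphic g h].

Definition iso_classes (r : nat) : {set {set sgraph 'I_r}} :=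
  [set iso_class g | g : sgraph 'I_r].

(* g lists one representative of each isomorphism class of graphs with r
   vertices, without repetition and starting with the edgeless graph. *)
Definition enumerates_classes (r m : nat) (g : 'I_m.+1 -> sgraph 'I_r) : Prop :=
  [/\ g ord0 = edgeless 'I_r,
      injective (fun i => iso_class (g i))
    & [set iso_class (g i) | i : 'I_m.+1] = iso_classes r].

Local Open Scope ring_scope.

Section Program.
Variables (r m : nat) (g : 'I_m.+1 -> sgraph 'I_r).

Definition E_transform : 'M[rat]_m.+1 :=
  \matrix_(i, j) (subgraph_count (g j) (g i))%:R.

(* The exponent is a signed integer: the terms with |g_l| < |g_h| are not
   truncated but vanish because E_transform l h = 0. *)
Definition coef_c (i j l : 'I_m.+1) : rat :=
  \sum_(h < m.+1)
    (-1) ^ ((edge_count (g l))%:Z - (edge_count (g h))%:Z)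
    * E_transform l h * E_transform h i * E_transform h j.

Definition D_matrix (n : nat) : 'M[rat]_m.+1 :=
  diag_mx (\row_i ('C(n - cv (g i), r - cv (g i)))%:R).

Definition objective (k n : nat) : 'cV[rat]_m.+1 :=
  \col_i
    let c := cv (g i) in
    let e := edge_count (g i) in
    let t := (-1) ^+ e * ('C(n - c, k - c))%:R in
    if ((c <= k) && (e != 'C(k, 2)) || (c < k))%N then t
    else if (c == k) && (e == 'C(k, 2)) then 1 + t
    else 0.

Definition feasible (n : nat) (z : 'cV[rat]_m.+1) : Prop :=
  [/\ forall i, z i 0 \is a Num.int,
      forall i, 0 <= z i 0,
      z ord0 0 = 1,
      forall i, (- (invmx E_transform)^T *m D_matrix n *m z) i 0 <= 0
    & forall i j, (cv (g i) + cv (g j) <= r)%N ->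
        z i 0 * z j 0 - \sum_(l < m.+1) coef_c i j l * z l 0 = 0].

Definition is_minimum (k n : nat) (mu : rat) : Prop :=
  (exists2 z, feasible n z & ((objective k n)^T *m z) 0 0 = mu) /\
  (forall z, feasible n z -> mu <= ((objective k n)^T *m z) 0 0).

Definition minimum_positive (k n : nat) : Prop :=
  exists2 mu, is_minimum k n mu & 0 < mu.

End Program.

(* Main.v *)
(* If r(k) > n, take a graph h on n vertices with neither a k-clique nor an
   independent k-set; z_i = I(g_i)(h) is feasible and has objective value 0.
   - Counting the r-subsets S of vertices together with the copies of g_j inside
     h[S] in two ways gives E^T y = D z, where y_i >= 0 is the number of S with
     h[S] of type g_i; this is (I).
   - Moebius inversion on the subgraphs of a graph shows that E is invertible,
     and that c_ij^l is the number of pairs of copies of g_i and g_j with union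
     g_l; sorting the pairs of copies in h by their union gives (II).
   - By inclusion-exclusion over the edges inside each k-set, f^T z is the number
     of k-cliques plus the number of independent k-sets of h. *)
Require Import Defs.
From mathcomp Require Import all_boot all_order all_algebra.

Set Implicit Arguments.
Unset Strict Implicit.
Unset Printing Implicit Defensive.

Import Order.TTheory GRing.Theory Num.Theory.

(** * Isomorphism as an equivalence relation *)

Lemma isomorphicP (T U : finType) (g : sgraph T) (h : sgraph U) :
  reflect (exists2 f : T -> U, bijective f &
             edges h = [set f @: (e : {set T}) | e in edges g])
          (isomorphic g h).
Proof.
apply: (iffP existsP) => [[f /and3P[/injectiveP fI /forallP fS /eqP ->]]|].
  exists f => //; apply: inj_card_bij => //.
  rewrite -(card_codom fI); apply: subset_leq_card.
  by apply/subsetP => y _; apply: fS.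
case=> f fB hE; exists (finfun f); apply/and3P; split.
- by apply/injectiveP => x y; rewrite !ffunE; apply: (bij_inj fB).
- apply/forallP => y; have [f' _ fK'] := fB.
  by apply/codomP; exists (f' y); rewrite ffunE fK'.
- apply/eqP; rewrite hE; apply: eq_imset => e; apply: eq_imset => x.
  by rewrite ffunE.
Qed.

Lemma isomorphic_refl (T : finType) (g : sgraph T) : isomorphic g g.
Proof.
apply/isomorphicP; exists id; first by exists id.
rewrite -[LHS]imset_id; apply: eq_imset => e; exact/esym/imset_id.
Qed.

Lemma isomorphic_trans (T U V : finType) (g : sgraph T) (h : sgraph U)
    (k : sgraph V) : isomorphic g h -> isomorphic h k -> isomorphic g k.
Proof.
move=> /isomorphicP[f fB hE] /isomorphicP[f' fB' kE]; apply/isomorphicP.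
exists (f' \o f); first exact: bij_comp.
by rewrite kE hE -imset_comp; apply: eq_imset => e; rewrite /= -imset_comp.
Qed.

Lemma isomorphic_sym (T U : finType) (g : sgraph T) (h : sgraph U) :
  isomorphic g h -> isomorphic h g.
Proof.
move=> /isomorphicP[f [f' fK fK'] hE]; apply/isomorphicP.
exists f'; first by exists f.
rewrite hE -imset_comp -[LHS]imset_id; apply: eq_imset => e /=.
rewrite -imset_comp -[LHS]imset_id; apply: eq_imset => x /=.
by rewrite fK.
Qed.

(** * Subgraphs, unions, induced subgraphs and Moebius inversion on one vertex set *)

Section GraphOps.
Variable T : finType.
Implicit Types (s t h : sgraph T) (e : {set T}) (A : {set {set T}}).

Lemma edges_inj : injective (@edges T).
Proof. exact: val_inj. Qed.

Definition subgraph s h := edges s \subset edges h.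

Lemma card_edge s e : e \in edges s -> #|e| = 2.
Proof. by move=> es; apply/eqP/(forall_inP (edgesP s)). Qed.

Lemma edge_sub_nonisolated s e : e \in edges s -> e \subset nonisolated s.
Proof. by move=> es; apply: bigcup_sup. Qed.

Lemma graph_of_subproof A : [forall e in [set e in A | #|e| == 2], #|e| == 2].
Proof. by apply/forall_inP => e; rewrite inE => /andP[]. Qed.

(** Filtering by cardinality 2 makes this total: any family of sets yields a graph, and
    [edges_graph_of] removes the filter when all members are pairs. *)
Definition graph_of A : sgraph T := SGraph (graph_of_subproof A).

Lemma edges_graph_of A : {in A, forall e, #|e| = 2} -> edges (graph_of A) = A.
Proof.
move=> A2; apply/setP => e; rewrite inE.
by case: (boolP (e \in A)) => // /A2 ->.
Qed.

Lemma subgraph_refl s : subgraph s s.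
Proof. exact: subxx. Qed.

Lemma subgraph_nonisolated s h : subgraph s h -> nonisolated s \subset nonisolated h.
Proof.
move=> sh; apply/bigcupsP => e es.
by apply/edge_sub_nonisolated/(subsetP sh).
Qed.

Lemma leq_cv s h : subgraph s h -> cv s <= cv h.
Proof. by move=> /subgraph_nonisolated; apply: subset_leq_card. Qed.

Definition graph_union s t := graph_of (edges s :|: edges t).

Lemma edges_union s t : edges (graph_union s t) = edges s :|: edges t.
Proof. by apply: edges_graph_of => e /setUP[] /card_edge. Qed.

Lemma subgraph_union s t h :
  subgraph (graph_union s t) h = subgraph s h && subgraph t h.
Proof. by rewrite /subgraph edges_union subUset. Qed.

Lemma cv_union s t : cv (graph_union s t) <= cv s + cv t.
Proof.
rewrite /cv; apply: leq_trans (leq_card_setU _ _); apply: subset_leq_card.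
apply/bigcupsP => e; rewrite edges_union => /setUP[] /edge_sub_nonisolated es.
  by apply: subset_trans es (subsetUl _ _).
by apply: subset_trans es (subsetUr _ _).
Qed.

Definition induced h (S : {set T}) := graph_of [set e in edges h | e \subset S].

Lemma edges_induced h S : edges (induced h S) = [set e in edges h | e \subset S].
Proof. by apply: edges_graph_of => e; rewrite inE => /andP[/card_edge]. Qed.

Lemma subgraph_induced s h S :
  subgraph s (induced h S) = subgraph s h && (nonisolated s \subset S).
Proof.
rewrite /subgraph edges_induced; apply/idP/andP => [/subsetP sh|[/subsetP sh nS]].
  split; first by apply/subsetP => e /sh; rewrite inE => /andP[].
  by apply/bigcupsP => e /sh; rewrite inE => /andP[].
apply/subsetP => e es; rewrite inE sh //=.
exact: subset_trans (edge_sub_nonisolated es) nS.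
Qed.

Lemma cv_induced h S : cv (induced h S) <= #|S|.
Proof.
have := subgraph_induced (induced h S) h S.
by rewrite subgraph_refl => /esym/andP[_ /subset_leq_card].
Qed.

(** For a pair [e], this is the sign-reversing involution behind Moebius inversion. *)
Definition toggle e s :=
  graph_of (if e \in edges s then edges s :\ e else e |: edges s).

Lemma edges_toggle e s : #|e| = 2 ->
  edges (toggle e s) = if e \in edges s then edges s :\ e else e |: edges s.
Proof.
move=> e2; apply: edges_graph_of => e'.
by case: ifP => _ => [/setD1P[_]|/setU1P[->|]] // /card_edge.
Qed.

Lemma toggleK e : #|e| = 2 -> involutive (toggle e).
Proof.
move=> e2 s; apply: edges_inj; rewrite !edges_toggle //.
case: (boolP (e \in edges s)) => es.
  by rewrite setD11 setD1K.
by rewrite setU11 setU1K.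
Qed.

Lemma subgraph_toggle_sup e s t : #|e| = 2 -> e \notin edges t ->
  subgraph t (toggle e s) = subgraph t s.
Proof.
move=> e2 et; rewrite /subgraph edges_toggle //; case: ifP => es.
  by rewrite subsetD1 et andbT.
apply/idP/idP => [/subsetP ts|ts]; last exact: subset_trans ts (subsetUr _ _).
apply/subsetP => x xt; have /setU1P[xe|//] := ts x xt.
by rewrite -xe xt in et.
Qed.

Lemma subgraph_toggle_sub e s h : #|e| = 2 -> e \in edges h ->
  subgraph (toggle e s) h = subgraph s h.
Proof.
move=> e2 eh; rewrite /subgraph edges_toggle //; case: ifP => es.
  by rewrite subDset setUC (setUidPl _) // sub1set.
by rewrite subUset sub1set eh.
Qed.

Local Open Scope ring_scope.

Lemma sign_toggle e s : #|e| = 2%N ->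
  (-1) ^+ edge_count (toggle e s) = - (-1) ^+ edge_count s :> rat.
Proof.
move=> e2; rewrite /edge_count edges_toggle //; case: ifP => es.
  by rewrite [in RHS](cardsD1 e) es exprS mulN1r opprK.
by rewrite cardsU1 es exprS mulN1r.
Qed.

(** The graphs between [t] and [h] form a Boolean lattice, on which the alternating sum vanishes
    unless it is a single point. The exponent is a sum instead of a difference, which has the same
    parity and stays in [nat]. *)
Lemma moebius h t :
  \sum_(s | subgraph s h) (-1) ^+ (edge_count h + edge_count s) *
     (subgraph t s)%:R = (t == h)%:R :> rat.
Proof.
case: (eqVneq t h) => [->|neq].
  rewrite (bigD1 h) ?subgraph_refl //= big1 ?addr0.
    by rewrite mulr1 addnn -signr_odd odd_double.
  move=> s /andP[sh nsh]; case: (boolP (subgraph h s)) => [hs|_]; last by rewrite mulr0.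
  case/eqP: nsh; apply: edges_inj; apply/eqP; rewrite eqEsubset.
  by rewrite [X in X && _]sh.
case: (boolP (subgraph t h)) => [th|nth]; last first.
  rewrite big1 // => s sh; case: (boolP (subgraph t s)) => [ts|_]; last by rewrite mulr0.
  by case/negP: nth; apply: subset_trans ts sh.
have [e eh et] : exists2 e, e \in edges h & e \notin edges t.
  apply/subsetPn; apply: contra neq => ht; apply/eqP/edges_inj/eqP.
  by rewrite eqEsubset [X in X && _]th.
have e2 := card_edge eh.
(* Toggling e reverses the sign and preserves the range of summation. *)
set S := LHS; suff: S = - S.
  by move/eqP; rewrite -subr_eq0 opprK -mulr2n mulrn_eq0 => /eqP.
rewrite {1}/S (reindex_inj (inv_inj (toggleK e2))) -sumrN.
apply: eq_big => s; first by rewrite subgraph_toggle_sub.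
by rewrite subgraph_toggle_sup // !exprD sign_toggle // mulrN mulNr.
Qed.

End GraphOps.

(** * Images of graphs under vertex maps, and graphs up to isolated vertices *)

Definition push (T U : finType) (f : T -> U) (s : sgraph T) : sgraph U :=
  graph_of [set f @: (e : {set T}) | e in edges s].

Section Push.
Variables (T U : finType) (f : T -> U) (s : sgraph T).
Hypothesis fI : {in nonisolated s &, injective f}.

Lemma edges_push : edges (push f s) = [set f @: (e : {set T}) | e in edges s].
Proof.
apply: edges_graph_of => _ /imsetP[e es ->].
rewrite card_in_imset ?(card_edge es) // => x y xe ye.
by apply: fI; apply: (subsetP (edge_sub_nonisolated es)).
Qed.

End Push.

Lemma edges_core (T : finType) (g : sgraph T) :
  edges g =
  [set val @: (e : {set {x | x \in nonisolated g}}) | e in edges (core g)].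
Proof.
apply/setP => e; apply/idP/imsetP => [eg|[e']]; last by rewrite inE => ? ->.
have vK : val @: (val @^-1: e : {set {x | x \in nonisolated g}}) = e.
  apply/setP => x; apply/imsetP/idP => [[y]|xe]; first by rewrite inE => ? ->.
  have xn := subsetP (edge_sub_nonisolated eg) _ xe.
  by exists (exist _ x xn); rewrite ?inE.
by exists (val @^-1: e); rewrite ?inE vK.
Qed.

Definition same_type (T U : finType) (g : sgraph T) (h : sgraph U) :=
  isomorphic (core g) (core h).

(** Replaces bijections between the subtypes of non-isolated vertices by plain maps on all vertices,
    injective where it matters; such maps are easier to compose, restrict and extend. *)
Lemma same_typeP (T U : finType) (u0 : U) (g : sgraph T) (h : sgraph U) :
  reflect (exists2 f : T -> U, {in nonisolated g &, injective f} &
             edges h = [set f @: (e : {set T}) | e in edges g])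
          (same_type g h).
Proof.
apply: (iffP (isomorphicP _ _)) => [[f fB hE]|[f fI hE]].
  (* Isolated vertices are sent to the default [u0]; they meet no edge. *)
  pose f' x :=
    if (insub x : option {x | x \in nonisolated g}) is Some u then val (f u)
    else u0.
  have f'E (x : {x | x \in nonisolated g}) : f' (val x) = val (f x).
    by rewrite /f' valK.
  exists f'.
    move=> x y xn yn; have := f'E (exist _ x xn); have := f'E (exist _ y yn).
    by rewrite /= => -> -> /val_inj/(bij_inj fB)[].
  rewrite edges_core hE [in RHS]edges_core -!imset_comp.
  apply: eq_imset => e /=.
  by rewrite -!imset_comp; apply: eq_imset => x; apply/esym/f'E.
have fP (x : {x | x \in nonisolated g}) : f (val x) \in nonisolated h.
  have /bigcupP[e eg xe] := valP x; apply/bigcupP; exists (f @: e).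
    by rewrite hE imset_f.
  exact: imset_f.
pose F x : {x | x \in nonisolated h} := exist _ (f (val x)) (fP x).
have FI : injective F.
  by move=> x y [/fI] xy; apply: val_inj; apply: xy; apply: valP.
exists F.
  apply: inj_card_bij => //; rewrite -(card_codom FI); apply: subset_leq_card.
  apply/subsetP => -[y yn] _; have /bigcupP[e'] := yn.
  rewrite hE => /imsetP[e eg ->] /imsetP[x xe yE].
  have xn := subsetP (edge_sub_nonisolated eg) _ xe.
  by apply/codomP; exists (exist _ x xn); apply: val_inj.
apply: (imset_inj (imset_inj val_inj)).
rewrite -edges_core hE edges_core -!imset_comp; apply: eq_imset => e /=.
by rewrite -!imset_comp.
Qed.

Lemma imset_inj_in (T U : finType) (f : T -> U) (A B C : {set T}) :
  {in A &, injective f} -> B \subset A -> C \subset A -> f @: B = f @: C -> B = C.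
Proof.
move=> fI /subsetP BA /subsetP CA E; apply/eqP; rewrite eqEsubset.
apply/andP; split; apply/subsetP => x xB.
  have: f x \in f @: C by rewrite -E imset_f.
  by case/imsetP => y yC /fI -> //; [apply: BA | apply: CA].
have: f x \in f @: B by rewrite E imset_f.
by case/imsetP => y yC /fI -> //; [apply: CA | apply: BA].
Qed.

Lemma same_type_cv (T U : finType) (g : sgraph T) (h : sgraph U) :
  same_type g h -> cv g = cv h.
Proof.
case/isomorphicP => f fB _; rewrite /cv -(card_sig (mem (nonisolated g))).
by rewrite -(card_sig (mem (nonisolated h))) (bij_eq_card fB).
Qed.

Lemma edge_count_core (T : finType) (g : sgraph T) :
  edge_count (core g) = edge_count g.
Proof.
by rewrite /edge_count [in RHS]edges_core card_imset //; apply/imset_inj/val_inj.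
Qed.

Lemma same_type_edge_count (T U : finType) (g : sgraph T) (h : sgraph U) :
  same_type g h -> edge_count g = edge_count h.
Proof.
case/isomorphicP => f fB hE.
rewrite -edge_count_core -[RHS]edge_count_core /edge_count hE card_imset //.
exact/imset_inj/(bij_inj fB).
Qed.

Lemma isomorphic_same_type (T U : finType) (u0 : U) (g : sgraph T)
    (h : sgraph U) : isomorphic g h -> same_type g h.
Proof.
case/isomorphicP => f fB hE; apply/(same_typeP u0); exists f => //.
by move=> x y _ _; apply: (bij_inj fB).
Qed.

(** The complements of [A] and of its image have equal size, so they can be matched by position in
    their enumerations. *)
Lemma bijective_extension (T : finType) (A : {set T}) (f : T -> T) :
  {in A &, injective f} -> exists2 f' : T -> T, bijective f' & {in A, f' =1 f}.
Proof.
move=> fI; pose B := f @: A.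
have AB : #|~: A| = #|~: B|.
  by apply/eqP; rewrite -(eqn_add2l #|A|) cardsC -{1}(card_in_imset fI) cardsC.
pose f' x := if x \in A then f x else nth x (enum (~: B)) (index x (enum (~: A))).
have idx x : x \notin A -> index x (enum (~: A)) < size (enum (~: B)).
  by move=> xA; rewrite -cardE -AB cardE index_mem mem_enum inE.
have f'A x : x \notin A -> f' x \notin B.
  move=> xA; rewrite /f' (negPf xA); have := mem_nth x (idx x xA).
  by rewrite mem_enum inE.
exists f'; last by move=> x xA; rewrite /f' xA.
apply: injF_bij => x y; case: (boolP (x \in A)) => xA; case: (boolP (y \in A)) => yA.
- by rewrite /f' xA yA; apply: fI.
- by move=> E; have := f'A _ yA; rewrite -E /f' xA imset_f.
- by move=> E; have := f'A _ xA; rewrite E /f' yA imset_f.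
rewrite /f' (negPf xA) (negPf yA) (set_nth_default x y) ?idx // => /eqP.
rewrite nth_uniq ?idx ?enum_uniq // => /eqP E.
by rewrite -(nth_index x (s := enum (~: A)) (x := x)) ?E ?nth_index ?mem_enum ?inE.
Qed.

(** On a common vertex set, the injection on non-isolated vertices extends to a permutation. The
    empty vertex set is treated apart, as it offers no default vertex. *)
Lemma same_type_isomorphic (T : finType) (g h : sgraph T) :
  same_type g h -> isomorphic g h.
Proof.
move=> gh; case: (pickP (fun _ : T => true)) => [x0 _|T0].
  have /(same_typeP x0)[f /bijective_extension[f' fB ff'] hE] := gh.
  apply/isomorphicP; exists f' => //; rewrite hE; apply: eq_in_imset => e eg.
  apply: eq_in_imset => x xe; apply/esym/ff'.
  exact: (subsetP (edge_sub_nonisolated eg)).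
suff -> : g = h by apply: isomorphic_refl.
have noedge (s : sgraph T) : edges s = set0.
  apply/setP => e; rewrite inE; apply/negP => /card_edge e2.
  have /card_gt0P[x _] : 0 < #|e| by rewrite e2.
  by have := T0 x.
by apply: edges_inj; rewrite !noedge.
Qed.

(** Pushing along the map from [h] to [h'] sends copies of [g] in [h] injectively to copies of [g]
    in [h']. *)
Lemma subgraph_count_le (T U V : finType) (u0 : U) (g : sgraph V) (h : sgraph T)
    (h' : sgraph U) :
  same_type h h' -> subgraph_count g h <= subgraph_count g h'.
Proof.
move=> /(same_typeP u0)[f fI h'E].
have fIs (s : sgraph T) :
    edges s \subset edges h -> {in nonisolated s &, injective f}.
  move=> sh; have /subsetP ni := subgraph_nonisolated sh; move=> x y xs ys.
  by apply: fI; apply: ni.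
rewrite /subgraph_count -(card_in_imset (f := push f)).
  apply: subset_leq_card; apply/subsetP => _ /imsetP[s sh ->].
  move: sh; rewrite !inE => /andP[sh gs]; rewrite edges_push; last exact: fIs.
  rewrite h'E imsetS //=; apply: isomorphic_trans gs _.
  apply/(same_typeP u0); exists f; first exact: fIs.
  by apply: edges_push; apply: fIs.
move=> s t; rewrite !inE => /andP[sh _] /andP[th _] /(congr1 (@edges U)).
rewrite !edges_push; try exact: fIs.
move=> E; apply/edges_inj/(imset_inj_in _ sh th E) => d e dh eh /=.
by apply: imset_inj_in fI _ _; apply: edge_sub_nonisolated.
Qed.

Lemma subgraph_count_same_type (T U V : finType) (t0 : T) (u0 : U)
    (g : sgraph V) (h : sgraph T) (h' : sgraph U) :
  same_type h h' -> subgraph_count g h = subgraph_count g h'.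
Proof.
move=> hh'; apply/eqP; rewrite eqn_leq (subgraph_count_le u0) //=.
exact/(subgraph_count_le t0)/isomorphic_sym.
Qed.

(** * Counting supersets and copies *)

Lemma cards_supersets (T : finType) (A : {set T}) (r : nat) : #|A| <= r ->
  #|[set S : {set T} | (#|S| == r) && (A \subset S)]| = 'C(#|T| - #|A|, r - #|A|).
Proof.
move=> Ar; have <- : #|~: A| = #|T| - #|A| by rewrite -(cardsC A) addKn.
(* Removing [A] is a bijection onto the subsets of its complement with [r - #|A|] elements. *)
rewrite -cards_draws -[LHS](card_in_imset (f := fun S => S :\: A)).
  congr #|pred_of_set _|; apply/setP => B; rewrite inE; apply/imsetP/idP.
    case=> S; rewrite inE => /andP[/eqP Sr AS] ->.
    rewrite setDE subsetIr /= -setDE cardsD (setIidPr AS) Sr eqxx //.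
  case/andP => BA /eqP Br; exists (A :|: B).
    rewrite inE subsetUl andbT cardsU; move: BA; rewrite -disjoints_subset disjoint_sym.
    by rewrite -setI_eq0 => /eqP ->; rewrite cards0 subn0 Br subnKC.
  by rewrite setDUl setDv set0U; apply/esym/setDidPl; rewrite disjoints_subset.
move=> S S'; rewrite !inE => /andP[_ AS] /andP[_ AS'] E.
by rewrite -[S](setID _ A) -[S'](setID _ A) (setIidPr AS) (setIidPr AS') E.
Qed.

Local Open Scope ring_scope.

(** A sum of indicators over all copies lets the double counts below be done by exchanging sums. *)
Lemma natr_subgraph_count (T U : finType) (g : sgraph T) (h : sgraph U) :
  (subgraph_count g h)%:R = \sum_(s | same_type g s) (subgraph s h)%:R :> rat.
Proof.
rewrite /subgraph_count -sum1dep_card natr_sum big_mkcond [RHS]big_mkcond.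
apply: eq_bigr => s _; rewrite /subgraph /same_type.
by case: (edges s \subset _); case: isomorphic.
Qed.

(** * Sums over isomorphism classes versus sums over concrete subgraphs *)

Section Classes.
Variables (r m : nat) (g : 'I_m.+1 -> sgraph 'I_r).
Hypotheses (r_gt0 : (0 < r)%N) (hg : enumerates_classes g).

Let i0 : 'I_r := Ordinal r_gt0.

Lemma class_uniq (T : finType) (s : sgraph T) i j :
  same_type (g i) s -> same_type (g j) s -> i = j.
Proof.
case: hg => _ gI _ gis gjs; apply: gI; apply/setP => h; rewrite !inE.
have ij : isomorphic (g i) (g j).
  exact/same_type_isomorphic/(isomorphic_trans gis)/isomorphic_sym.
apply/idP/idP; last exact: isomorphic_trans.
exact/isomorphic_trans/isomorphic_sym.
Qed.

(** Numbering the at most [r] non-isolated vertices of [s] relabels it as a graph on ['I_r]. *)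
Lemma class_exists (T : finType) (t0 : T) (s : sgraph T) :
  (cv s <= r)%N -> exists i, same_type (g i) s.
Proof.
move=> sr; pose f x := insubd i0 (index x (enum (nonisolated s))).
have fI : {in nonisolated s &, injective f}.
  have lt x : x \in nonisolated s -> (index x (enum (nonisolated s)) < r)%N.
    by move=> xs; apply: leq_trans sr; rewrite /cv cardE index_mem mem_enum.
  move=> x y xs ys /(congr1 val); rewrite !val_insubd !lt //.
  by apply: (index_inj x); rewrite mem_enum.
have sp : same_type s (push f s).
  by apply/(same_typeP i0); exists f => //; apply: edges_push.
case: hg => _ _ gS; have : iso_class (push f s) \in iso_classes r by apply: imset_f.
rewrite -gS => /imsetP[i _ E]; exists i.
apply: isomorphic_trans (isomorphic_sym sp); apply: (isomorphic_same_type i0).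
have : push f s \in iso_class (push f s) by rewrite inE isomorphic_refl.
by rewrite E inE.
Qed.

Lemma cv_class i : (cv (g i) <= r)%N.
Proof. by rewrite -[X in (_ <= X)%N](card_ord r) max_card. Qed.

(** Each subgraph of [h] with at most [r] non-isolated vertices belongs to exactly one class, and
    larger ones to none; hence the restriction on [cv s]. *)
Lemma sum_by_class (T : finType) (t0 : T) (h : sgraph T) (F : sgraph T -> rat)
    (G : 'I_m.+1 -> rat) :
  (forall i s, same_type (g i) s -> F s = G i) ->
  \sum_i (subgraph_count (g i) h)%:R * G i =
  \sum_(s | subgraph s h && (cv s <= r)%N) F s.
Proof.
move=> FG; pose P i (s : sgraph T) := same_type (g i) s.
transitivity (\sum_i \sum_(s | P i s) (subgraph s h)%:R * F s).
  apply: eq_bigr => i _; rewrite natr_subgraph_count mulr_suml.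
  by apply: eq_bigr => s /FG ->.
rewrite (exchange_big_dep predT) //= [RHS]big_mkcond; apply: eq_bigr => s _.
case: (boolP (subgraph s h)) => sh /=; last by rewrite big1 // => i _; rewrite mul0r.
under eq_bigr do rewrite mul1r.
case: (leqP (cv s) r) => sr.
  have [i gis] := class_exists t0 sr.
  rewrite (big_pred1 i) // => j; apply/idP/eqP => [gjs|->//].
  exact: class_uniq gjs gis.
rewrite big_pred0 // => i; apply: contraTF sr => /same_type_cv <-.
by rewrite -leqNgt cv_class.
Qed.

Lemma sum_subgraphs_by_class (T : finType) (t0 : T) (u : sgraph T)
    (F : sgraph T -> rat) (G : 'I_m.+1 -> rat) : (cv u <= r)%N ->
  (forall i s, same_type (g i) s -> F s = G i) ->
  \sum_i (subgraph_count (g i) u)%:R * G i = \sum_(s | subgraph s u) F s.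
Proof.
move=> ur /(sum_by_class t0) ->; apply: eq_bigl => s.
by case: (boolP (subgraph s u)) => //= /leq_cv su; apply: leq_trans su ur.
Qed.

(** * Inversion of E and the meaning of the coefficients in (II) *)

Definition E_inverse : 'M[rat]_m.+1 :=
  \matrix_(l, h) ((-1) ^+ (edge_count (g l) + edge_count (g h)) *
                  E_transform g l h).

(** The sum over classes becomes a sum over the subgraphs of [g l]; expanding the remaining count
    into copies [t], [moebius] leaves only [t = g l]. *)
Lemma mul_E_inverse : E_inverse *m E_transform g = 1%:M.
Proof.
apply/matrixP => l i; rewrite !mxE.
transitivity (\sum_h (subgraph_count (g h) (g l))%:R *
    ((-1) ^+ (edge_count (g l) + edge_count (g h)) *
     (subgraph_count (g i) (g h))%:R) : rat).
  by apply: eq_bigr => h _; rewrite !mxE mulrCA -mulrA.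
rewrite (sum_subgraphs_by_class i0 (F := fun s =>
    (-1) ^+ (edge_count (g l) + edge_count s) * (subgraph_count (g i) s)%:R)).
- under eq_bigr => s _ do rewrite natr_subgraph_count mulr_sumr.
  rewrite exchange_big /=; under eq_bigr => t _ do rewrite moebius.
  rewrite big_mkcond (bigD1 (g l)) //= eqxx big1 ?addr0.
    case: eqVneq => [->|li]; first by rewrite /same_type isomorphic_refl.
    case: ifP => // gil; case/eqP: li; apply: (class_uniq (s := g l)) => //.
    exact: isomorphic_refl.
  by move=> t /negPf ->; case: ifP.
- exact: cv_class.
move=> h s gs; rewrite (same_type_edge_count gs).
by rewrite (subgraph_count_same_type i0 i0 _ gs).
Qed.

Lemma E_transform_unit : E_transform g \in unitmx.
Proof. by have [] := mulmx1_unit mul_E_inverse. Qed.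

(** Links the integer exponent in [coef_c] to the natural one in [moebius]. *)
Lemma signz_sub (a b : nat) : (-1) ^ (a%:Z - b%:Z) = (-1) ^+ (a + b) :> rat.
Proof. by rewrite expfzDr // -invr_expz -!exprnP -exprVn invrN1 exprD. Qed.

(** Two graphs lie in [w] exactly when their union does, so the product of the two counts in [w]
    sums over all unions contained in [w]; Moebius inversion extracts the pairs with union exactly
    [u]. *)
Lemma coef_c_unions (T : finType) (t0 : T) (u : sgraph T) i j l :
  same_type (g l) u ->
  coef_c g i j l = \sum_(s | same_type (g i) s) \sum_(t | same_type (g j) t)
                     (graph_union s t == u)%:R.
Proof.
(* [N] is generic in the vertex type because it is evaluated both at representatives and at
   subgraphs of [u]. *)
move=> lu; pose N (T' : finType) (w : sgraph T') : rat :=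
  (subgraph_count (g i) w)%:R * (subgraph_count (g j) w)%:R.
transitivity (\sum_h (subgraph_count (g h) u)%:R *
    ((-1) ^+ (edge_count u + edge_count (g h)) * N _ (g h))).
  apply: eq_bigr => h _; rewrite !mxE signz_sub (same_type_edge_count lu).
  rewrite (subgraph_count_same_type i0 t0 _ lu) -!mulrA mulrCA; congr (_ * _).
rewrite (sum_subgraphs_by_class t0 (F := fun s =>
    (-1) ^+ (edge_count u + edge_count s) * N _ s)).
- rewrite /N; under eq_bigr => w _ do
    rewrite !natr_subgraph_count big_distrlr /= mulr_sumr.
  rewrite exchange_big; apply: eq_bigr => s _ /=.
  under eq_bigr => w _ do rewrite mulr_sumr.
  rewrite exchange_big; apply: eq_bigr => t _ /=.
  rewrite -moebius; apply: eq_bigr => w _.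
  by rewrite subgraph_union -natrM mulnb.
- by rewrite -(same_type_cv lu) cv_class.
move=> h s gs; rewrite (same_type_edge_count gs) /N.
by rewrite !(subgraph_count_same_type i0 t0 _ gs).
Qed.

(** * The subgraph counts of a fixed graph satisfy the constraints *)

Section Host.
Variables (T : finType) (t0 : T) (h : sgraph T).

Definition count_vector : 'cV[rat]_m.+1 := \col_i (subgraph_count (g i) h)%:R.

Lemma count_vector_edgeless : count_vector ord0 0 = 1.
Proof.
rewrite mxE natr_subgraph_count; case: hg => -> _ _.
have edgeless_sub : subgraph (edgeless T) h by rewrite /subgraph sub0set.
rewrite (big_pred1 (edgeless T)) ?edgeless_sub // => s.
apply/idP/eqP => [/same_type_edge_count|->].
  rewrite /edge_count cards0 => /esym/eqP; rewrite cards_eq0 => /eqP s0.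
  exact: edges_inj.
apply/(same_typeP t0); exists (fun _ => t0); last by rewrite imset0.
move=> x y /bigcupP[e]; by rewrite inE.
Qed.

(** Pairs of copies in [h] are sorted by their union, which has at most [r] non-isolated vertices
    and so falls into one of the classes. *)
Lemma count_vector_mul i j : (cv (g i) + cv (g j) <= r)%N ->
  count_vector i 0 * count_vector j 0 =
  \sum_l coef_c g i j l * count_vector l 0.
Proof.
move=> ijr; under [RHS]eq_bigr => l _ do rewrite mxE mulrC.
rewrite (sum_by_class t0 _ (F := fun u : sgraph T => \sum_(s | same_type (g i) s)
   \sum_(t | same_type (g j) t) (graph_union s t == u)%:R)); last first.
  by move=> l u lu; rewrite (coef_c_unions t0 _ _ lu).
rewrite !mxE !natr_subgraph_count big_distrlr /= [RHS]exchange_big.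
apply: eq_bigr => s gs; rewrite exchange_big; apply: eq_bigr => t gt /=.
rewrite -natrM mulnb -subgraph_union.
have ur : (cv (graph_union s t) <= r)%N.
  apply: leq_trans (cv_union s t) _.
  by rewrite -(same_type_cv gs) -(same_type_cv gt).
rewrite big_mkcond (bigD1 (graph_union s t)) //= eqxx ur andbT big1 ?addr0.
  by case: ifP.
by move=> u /negPf; rewrite eq_sym => ->; case: ifP.
Qed.

(** The case split guards against truncated subtraction: for [cv s > q] the binomial would be 1
    instead of 0. *)
Lemma sum_supersets (s : sgraph T) (q : nat) :
  \sum_(S : {set T} | #|S| == q) (nonisolated s \subset S)%:R =
  (if (cv s <= q)%N then 'C(#|T| - cv s, q - cv s)%:R else 0) :> rat.
Proof.
rewrite -natr_sum; case: leqP => sq; last first.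
  rewrite big1 // => S /eqP Sq; case: (boolP (_ \subset _)) => // /subset_leq_card.
  by rewrite Sq leqNgt -[#|nonisolated s|]/(cv s) sq.
rewrite -cards_supersets // -sum1dep_card [in RHS]big_mkcondr; congr _%:R.
Qed.

Definition induced_vector : 'cV[rat]_m.+1 :=
  \col_i \sum_(S : {set T} | #|S| == r) (same_type (g i) (induced h S))%:R.

(** Both sides count pairs of an [r]-set [S] and a copy of [g j] inside the subgraph induced on [S]:
    first by the class of that subgraph, then by the copy. *)
Lemma mul_induced_vector :
  (E_transform g)^T *m induced_vector = D_matrix g #|T| *m count_vector.
Proof.
apply/colP => j; rewrite /D_matrix mul_diag_mx !mxE.
transitivity (\sum_(S : {set T} | #|S| == r)
    (subgraph_count (g j) (induced h S))%:R : rat).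
  under eq_bigr => i _ do rewrite !mxE mulr_sumr.
  rewrite exchange_big; apply: eq_bigr => S /eqP Sr /=.
  have [i gi] : exists i, same_type (g i) (induced h S).
    by apply: class_exists => //; rewrite -Sr cv_induced.
  rewrite (bigD1 i) //= gi mulr1 big1 ?addr0.
    by rewrite (subgraph_count_same_type i0 t0 _ gi).
  move=> i' /eqP ii'; case: (boolP (same_type _ _)) => gi'; last by rewrite mulr0.
  by case: ii'; apply: class_uniq gi' gi.
under eq_bigr => S _ do rewrite natr_subgraph_count.
rewrite exchange_big natr_subgraph_count mulr_sumr; apply: eq_bigr => s gs /=.
(* For a fixed copy [s] in [h], the admissible [S] are the [r]-sets containing its non-isolated
   vertices. *)
under eq_bigr => S _ do rewrite subgraph_induced -mulnb natrM.
rewrite -mulr_sumr sum_supersets mulrC; congr (_ * _).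
by rewrite -(same_type_cv gs) cv_class.
Qed.

(** Applying the inverse transpose of E to D z recovers [induced_vector], whose entries are
    cardinalities. *)
Lemma count_vector_induced_nonneg i :
  ((- (invmx (E_transform g))^T *m D_matrix g #|T| *m count_vector) i 0 <= 0).
Proof.
rewrite -mulmxA -mul_induced_vector mulmxA mulNmx -trmx_mul.
rewrite mulmxV ?E_transform_unit // trmx1 mulNmx mul1mx !mxE oppr_le0.
by apply: sumr_ge0 => S _; apply: ler0n.
Qed.

Lemma count_vector_feasible : feasible g #|T| count_vector.
Proof.
split; first by move=> i; rewrite mxE natr_int.
- by move=> i; rewrite mxE ler0n.
- exact: count_vector_edgeless.
- exact: count_vector_induced_nonneg.
by move=> i j ijr; rewrite count_vector_mul ?subrr.
Qed.

End Host.
End Classes.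

(** * The objective value, by inclusion-exclusion inside the k-sets *)

Lemma sum_sign_subgraphs (T : finType) (h : sgraph T) : h != edgeless T ->
  \sum_(s | subgraph s h) (-1) ^+ edge_count s = 0 :> rat.
Proof.
move=> /negPf h0; have := moebius h (edgeless T); rewrite eq_sym h0.
under eq_bigr => s _ do rewrite /subgraph sub0set mulr1 exprD.
by rewrite -mulr_sumr => /eqP; rewrite mulf_eq0 signr_eq0 => /eqP.
Qed.

Lemma induced_edgeless (T : finType) (h : sgraph T) (S : {set T}) :
  induced h S = edgeless T -> is_independent h S.
Proof.
move=> /(congr1 (@edges T)); rewrite edges_induced => h0.
apply/forall_inP => x xS; apply/forall_inP => y yS; apply/negP => xy.
have : [set x; y] \in (set0 : {set {set T}}).
  by rewrite -[set0]h0 inE [X in X && _]xy subUset !sub1set xS.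
by rewrite inE.
Qed.

(** The edges of [s] are pairs of its non-isolated vertices, and the edge count says that all such
    pairs occur. *)
Lemma complete_is_clique (T : finType) (s h : sgraph T) :
  subgraph s h -> edge_count s = 'C(cv s, 2) -> is_clique h (nonisolated s).
Proof.
move=> /subsetP sh sC.
have sE : edges s =
    [set e : {set T} | (e \subset nonisolated s) && (#|e| == 2%N)].
  apply/eqP; rewrite eqEcard cards_draws -[#|edges s|]/(edge_count s) sC leqnn andbT.
  by apply/subsetP => e es; rewrite inE edge_sub_nonisolated //= (card_edge es).
apply/forall_inP => x xS; apply/forall_inP => y yS; apply/implyP => xy.
by apply: sh; rewrite sE inE subUset !sub1set xS yS cards2 xy.
Qed.

Section Objective.
Variables (r m : nat) (g : 'I_m.+1 -> sgraph 'I_r).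
Hypotheses (r_gt0 : (0 < r)%N) (hg : enumerates_classes g).
Variables (k : nat) (T : finType) (t0 : T) (h : sgraph T).
Hypothesis kr : (k <= r)%N.
Hypothesis no_clique : forall S : {set T}, #|S| = k -> ~~ is_clique h S.
Hypothesis no_independent :
  forall S : {set T}, #|S| = k -> ~~ is_independent h S.

(** The coefficient of [objective] without the extra 1 in the clique class, for graphs on any vertex
    type. *)
Let weight (U : finType) (s : sgraph U) : rat :=
  if (cv s <= k)%N then (-1) ^+ edge_count s * ('C(#|T| - cv s, k - cv s))%:R
  else 0.

Lemma sum_weight_count :
  \sum_i (subgraph_count (g i) h)%:R * weight (g i) = 0.
Proof.
rewrite (sum_by_class r_gt0 hg t0 _ (F := fun s => weight s)); last first.
  by move=> i s gs; rewrite /weight (same_type_cv gs) (same_type_edge_count gs).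
(* The binomial in the weight counts the k-sets containing the non-isolated vertices of [s]. *)
transitivity (\sum_(s | subgraph s h) (-1) ^+ edge_count s *
   \sum_(S : {set T} | #|S| == k) (nonisolated s \subset S)%:R : rat).
  rewrite [LHS]big_mkcondr; apply: eq_bigr => s sh /=.
  rewrite sum_supersets /weight; case: (leqP (cv s) k) => sk.
    by rewrite (leq_trans sk kr).
  by rewrite mulr0; case: ifP.
under eq_bigr => s _ do rewrite mulr_sumr.
rewrite exchange_big big1 // => S /eqP Sk /=.
(* For each k-set [S] there remains the signed sum over subgraphs induced on [S]; it is zero, since
   [S] is not independent and so spans an edge. *)
rewrite -[RHS](sum_sign_subgraphs (h := induced h S)); last first.
  by apply: contra (no_independent Sk) => /eqP/induced_edgeless.
under [RHS]eq_bigl => s do rewrite subgraph_induced.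
rewrite [RHS]big_mkcondr; apply: eq_bigr => s _.
by case: ifP; rewrite ?mulr1 ?mulr0.
Qed.

Lemma count_clique_class i :
  cv (g i) = k -> edge_count (g i) = 'C(k, 2) -> subgraph_count (g i) h = 0%N.
Proof.
move=> ck eC; apply/eqP; rewrite cards_eq0; apply/eqP/setP => s.
rewrite [RHS]inE; apply/negP; rewrite inE => /andP[sh gs].
have sk : cv s = k by rewrite -ck (same_type_cv gs).
case/negP: (no_clique sk); apply: complete_is_clique => //.
by rewrite sk -eC (same_type_edge_count gs).
Qed.

(** The objective differs from the weight only by the 1 at the k-clique class, whose count in [h] is
    zero. *)
Lemma objective_count_vector :
  ((objective g k #|T|)^T *m count_vector g h) 0 0 = 0.
Proof.
rewrite mxE -[RHS]sum_weight_count; apply: eq_bigr => i _.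
rewrite !mxE /weight /= mulrC.
case: (ltngtP (cv (g i)) k) => //= [|ck]; first by rewrite orbT.
case: eqVneq => //= eC.
by rewrite count_clique_class // !mul0r.
Qed.

End Objective.

Local Close Scope ring_scope.

(** * The bound on the Ramsey number *)

Lemma ramsey_number_le (k r m : nat) (g : 'I_m.+1 -> sgraph 'I_r) (n : nat) :
  0 < k -> k <= r -> enumerates_classes g -> r <= n -> minimum_positive g k n ->
  ramsey_number k <= n.
Proof.
move=> k0 kr hg rn [mu [_ mu_min] mu_gt0]; rewrite /ramsey_number.
(* By minimality of [N] it suffices that [n] itself has the Ramsey property; [h] is a supposed
   counterexample. *)
case: ex_minnP => N _ minN; apply/minN/forallP => h; apply: contraT.
rewrite negb_exists => /forallP bad.
have r0 : 0 < r by apply: leq_trans kr.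
pose t0 : 'I_n := Ordinal (leq_trans r0 rn).
have /(_ (count_vector g h)) := mu_min.
rewrite -[X in feasible g X](card_ord n) -[X in objective g k X](card_ord n).
rewrite objective_count_vector //.
- by move/(_ (count_vector_feasible r0 hg t0 h)); rewrite leNgt mu_gt0.
- by move=> S Sk; have := bad S; rewrite Sk eqxx negb_or => /andP[].
- by move=> S Sk; have := bad S; rewrite Sk eqxx negb_or => /andP[].
Qed.

Theorem theorem4 (k r : nat) (hk : 2 <= k) (hkr : k <= r)
    (m : nat) (g : 'I_m.+1 -> sgraph 'I_r) (hg : enumerates_classes g) :
  (forall n, r <= n -> minimum_positive g k n -> ramsey_number k <= n) /\
  (forall n, r <= n -> minimum_positive g k n ->
     (forall n', r <= n' -> minimum_positive g k n' -> n <= n') ->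
     ramsey_number k <= n).
Proof.
have k0 : 0 < k by apply: ltnW.
have main n : r <= n -> minimum_positive g k n -> ramsey_number k <= n.
  exact: ramsey_number_le.
by split=> // n rn gn _; apply: main.
Qed.
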